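(* Let $V$ be a $C_2$ co-finite vertex operator algebra of CFT type and let $M$ be an irreducible weak $V$-module. If $M$ is $C_2$ co-finite, then $M$ is $C_n$ co-finite for all $n\ge 2$.
   Context: A vertex operator algebra $V=(V,Y,\mathbf 1,\omega)$ (over $\mathbb C$, with $Y(u,z)=\sum_{n\in\mathbb Z}u_nz^{-n-1}$) is of CFT type if its weight decomposition is $V=\bigoplus_{n\ge 0}V(n)$ with $V(0)=\mathbb C\mathbf 1$. $C_2(V)$ is the linear span of $\{u_{-2}v: u,v\in V\}$, and $V$ is $C_2$ co-finite if $V/C_2(V)$ is finite dimensional. A weak $V$-module is a vector space $M$ with a linear map $Y_M:V\to \mathrm{End}(M)[[z,z^{-1}]]$, $v\mapsto Y_M(v,z)=\sum_{n\in\mathbb Z}v_nz^{-n-1}$, such that $v_nm=0$ for $n\gg 0$ (for each $v\in V$, $m\in M$), $Y_M(\mathbf 1,z)=\mathrm{Id}_M$, and the Jacobi identity holds; no grading is assumed. For a weak $V$-module $M$, $C_n(M)$ is the linear span of $\{v_{-n}m: v\in V, m\in M\}$, and $M$ is called $C_n$ co-finite if $M/C_n(M)$ is finite dimensional. *)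

(* Defs.v *)
From HB Require Import structures.
From mathcomp Require Import all_boot all_order all_algebra.
From mathcomp Require Import complex.
From mathcomp Require Import boolp classical_sets functions cardinality fsbigop.
From mathcomp Require Import reals.

Set Implicit Arguments.
Unset Strict Implicit.
Unset Printing Implicit Defensive.

Import Order.TTheory GRing.Theory Num.Theory.

Local Open Scope classical_set_scope.
Local Open Scope ring_scope.

Section LinearAlgebra.
Variables (K : fieldType) (M : lmodType K).

Definition lin_span (A : set M) : set M :=
  [set x | exists (n : nat) (c : 'I_n -> K) (a : 'I_n -> M),
     (forall i, A (a i)) /\ x = \sum_(i < n) c i *: a i].

Definition linear_subspace (W : set M) : Prop :=
  W 0 /\ forall (c : K) (x y : M), W x -> W y -> W (c *: x + y).

Definition finite_dim (W : set M) : Prop :=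
  exists s : seq M, W `<=` lin_span [set` s].

(* [M / W] is finite dimensional: the classes of finitely many vectors of [M]
   span the quotient. *)
Definition finite_codim (W : set M) : Prop :=
  exists s : seq M,
    forall x : M, exists y : M, lin_span [set` s] y /\ W (x - y).

End LinearAlgebra.

(* [p (p - 1) ... (p - i + 1) / i!], for an arbitrary integer [p]. *)
Definition binomz (K : fieldType) (p : int) (i : nat) : K :=
  (\prod_(j < i) (p - (j : nat)%:Z)%:~R) / i`!%:R.

Section Modes.
Variables (K : fieldType) (V M : lmodType K).

(* [Y v n m] is [v_n m], where [Y(v, z) = \sum_n v_n z^(-n-1)]. *)
Implicit Type Y : V -> int -> M -> M.

Definition modes_bilinear Y : Prop :=
  (forall (n : int) (m : M), linear (fun v : V => Y v n m)) /\
  (forall (v : V) (n : int), linear (Y v n)).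

Definition modes_truncated Y : Prop :=
  forall (v : V) (m : M),
    exists N : int, forall n : int, N <= n -> Y v n m = 0.

Definition modes_vacuum (vac : V) Y : Prop :=
  forall (n : int) (m : M), Y vac n m = if n == -1 then m else 0.

(* The Jacobi identity
     z0^-1 delta((z1 - z2) / z0) Y(u, z1) Y(v, z2)
     - z0^-1 delta((z2 - z1) / (- z0)) Y(v, z2) Y(u, z1)
     = z2^-1 delta((z1 - z0) / z2) Y(YV(u, z0) v, z2)
   applied to [m]: equality of the coefficients of
   [z0^(-r-1) z1^(-p-1) z2^(-q-1)].  Both sums have finite support when [YV]
   and [Y] are truncated. *)
Definition jacobi_identity (YV : V -> int -> V -> V) Y : Prop :=
  forall (u v : V) (m : M) (p q r : int),
    \sum_(i \in [set: nat])
      (binomz K p i *: Y (YV u (r + i%:Z) v) (p + q - i%:Z) m)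
    = \sum_(i \in [set: nat])
      (((-1) ^+ i * binomz K r i) *:
        (Y u (p + r - i%:Z) (Y v (q + i%:Z) m)
         - (-1) ^ r *: Y v (q + r - i%:Z) (Y u (p + i%:Z) m))).

(* [C_n], the linear span of the vectors [v_{-n} m] *)
Definition C_span Y (n : nat) : set M :=
  lin_span [set x | exists (v : V) (m : M), x = Y v (- n%:Z) m].

Definition C_cofinite Y (n : nat) : Prop := finite_codim (C_span Y n).

End Modes.

(* [L(n) = omega_{n+1}] *)
Definition virasoro_mode (K : fieldType) (V : lmodType K)
    (Y : V -> int -> V -> V) (omega : V) (n : int) : V -> V :=
  Y omega (n + 1).

Definition weight_space (K : fieldType) (V : lmodType K)
    (Y : V -> int -> V -> V) (omega : V) (n : int) : set V :=
  [set v | virasoro_mode Y omega 0 v = n%:~R *: v].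

Record voa (R : realType) := Voa {
  voa_space :> lmodType R[i];
  vertex_op : voa_space -> int -> voa_space -> voa_space;
  vacuum : voa_space;
  conformal_vector : voa_space;
  central_charge : R[i];
  voa_bilinear : modes_bilinear vertex_op;
  voa_truncated : modes_truncated vertex_op;
  voa_vacuum : modes_vacuum vacuum vertex_op;
  voa_creation : forall v : voa_space,
    vertex_op v (-1) vacuum = v /\
    forall n : int, 0 <= n -> vertex_op v n vacuum = 0;
  voa_jacobi : jacobi_identity vertex_op vertex_op;
  voa_virasoro : forall (m n : int) (v : voa_space),
    let L := virasoro_mode vertex_op conformal_vector in
    L m (L n v) - L n (L m v) =
      (m - n)%:~R *: L (m + n) v +
      (if m + n == 0
       then ((m ^+ 3 - m)%:~R / 12%:R * central_charge) *: v else 0);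
  voa_L_derivative : forall (v : voa_space) (n : int) (w : voa_space),
    vertex_op (virasoro_mode vertex_op conformal_vector (-1) v) n w =
      (- n)%:~R *: vertex_op v (n - 1) w;
  (* [V] is the sum of its weight spaces; the sum is direct because these are
     eigenspaces of [L(0)] for distinct eigenvalues. *)
  voa_graded :
    lin_span (\bigcup_(n in [set: int])
                weight_space vertex_op conformal_vector n) = [set: voa_space];
  voa_weight_finite_dim : forall n : int,
    finite_dim (weight_space vertex_op conformal_vector n);
  voa_weight_bounded_below : exists N : int, forall n : int, n < N ->
    weight_space vertex_op conformal_vector n = [set 0]
}.

Definition voa_weight (R : realType) (V : voa R) (n : int) : set V :=
  weight_space (@vertex_op R V) (conformal_vector V) n.

Arguments voa_weight {R} V n.

Definition CFT_type (R : realType) (V : voa R) : Prop :=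
  (forall n : int, n < 0 -> voa_weight V n = [set 0]) /\
  voa_weight V 0 = [set c *: vacuum V | c in [set: R[i]]].

Definition voa_C2_cofinite (R : realType) (V : voa R) : Prop :=
  C_cofinite (@vertex_op R V) 2.

Record weak_module (R : realType) (V : voa R) := WeakModule {
  wmod_space :> lmodType R[i];
  wmod_op : V -> int -> wmod_space -> wmod_space;
  wmod_bilinear : modes_bilinear wmod_op;
  wmod_truncated : modes_truncated wmod_op;
  wmod_vacuum : modes_vacuum (vacuum V) wmod_op;
  wmod_jacobi : jacobi_identity (@vertex_op R V) wmod_op
}.

Definition weak_submodule (R : realType) (V : voa R) (M : weak_module V)
    (W : set M) : Prop :=
  linear_subspace W /\
  forall (v : V) (n : int) (m : M), W m -> W (wmod_op v n m).

Definition irreducible_weak_module (R : realType) (V : voa R)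
    (M : weak_module V) : Prop :=
  (exists m : M, m != 0) /\
  forall W : set M, weak_submodule W -> W = [set 0] \/ W = [set: M].

Definition wmod_C_cofinite (R : realType) (V : voa R) (M : weak_module V)
    (n : nat) : Prop :=
  C_cofinite (@wmod_op R V M) n.

(* Main.v *)
(* Fix [w <> 0] in [M]; by irreducibility the words in modes of homogeneous
   vectors applied to [w] span [M].  Modulo [C_n(M)] and a finite-dimensional
   space every word is zero, by induction on its total weight, then
   on its length, then (downwards) on the sum of the squares of its modes.
   Words may be reordered modulo lower weight, since commutators lower the
   weight, and a letter of large weight lies in [C_2(V)], which also lowers
   the weight.  A very negative mode moved to the left gives an element of
   [C_n(M)]; a large one moved to the right kills [w].  The modes that remain
   are in a bounded range, so a long word has a repeated mode, and
   [u_n v_n = (u_{-1} v)_{2n+1} - (products u_a v_b and v_b u_a with a + b = 2n,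
   a <> b)] modulo lower weight replaces it by a shorter word and by words with
   more spread out modes.  Short words with bounded modes and letters of bounded
   weight span a finite-dimensional space. *)
Require Import Defs.
From mathcomp Require Import all_boot all_order all_algebra.
From mathcomp Require Import zify ring.
From mathcomp Require Import complex.
From mathcomp Require Import boolp classical_sets fsbigop.
From mathcomp Require Import reals.

Set Implicit Arguments.
Unset Strict Implicit.
Unset Printing Implicit Defensive.

Import Order.TTheory GRing.Theory Num.Theory.

Local Open Scope classical_set_scope.
Local Open Scope ring_scope.

Lemma linear_fun0 (K : fieldType) (M N : lmodType K) (f : M -> N) :
  linear f -> f 0 = 0.
Proof. by move=> lf; have := lf (-1) 0 0; rewrite scaler0 addr0 scaleN1r addNr. Qed.

Lemma linear_funZ (K : fieldType) (M N : lmodType K) (f : M -> N) c x :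
  linear f -> f (c *: x) = c *: f x.
Proof.
by move=> lf; have := lf c x 0; rewrite (linear_fun0 lf) !addr0.
Qed.

Lemma seq_uniform_bound (T : eqType) (P : T -> nat -> Prop) (s : seq T) :
  (forall x m n, (m <= n)%N -> P x m -> P x n) ->
  (forall x, x \in s -> exists n, P x n) ->
  exists n, forall x, x \in s -> P x n.
Proof.
move=> Pmono; elim: s => [|x s IHs] Ps; first by exists 0%N.
have [|n Pn] := IHs; first by move=> y ys; apply: Ps; rewrite inE ys orbT.
have [m Pm] := Ps x (mem_head x s).
exists (maxn m n) => y; rewrite inE => /orP[/eqP ->|ys].
  exact: Pmono (leq_maxl _ _) Pm.
exact: Pmono (leq_maxr _ _) (Pn y ys).
Qed.

Lemma not_uniq_map_perm (T U : eqType) (f : T -> U) (s : seq T) :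
  ~~ uniq (map f s) ->
  exists x y q, perm_eq s (x :: y :: q) /\ f x = f y.
Proof.
elim: s => //= x s IHs; rewrite negb_and negbK => /orP[/mapP[y ys fxy]|].
  by exists x, y, (rem y s); split=> //; rewrite perm_cons perm_to_rem.
move=> /IHs[y [z [q [sq fyz]]]]; exists y, z, (x :: q); split=> //.
rewrite (perm_trans (_ : perm_eq _ (x :: [:: y; z] ++ q))) ?perm_cons //.
by rewrite -[x :: _]/([:: x] ++ [:: y; z] ++ q) perm_catCA.
Qed.

(** * Subspaces, linear spans and finitely supported sums *)

Section Subspaces.
Variables (K : fieldType) (M : lmodType K).
Implicit Types (W A : set M).

Lemma subspaceD W x y : linear_subspace W -> W x -> W y -> W (x + y).
Proof. by move=> [_ lW] Wx Wy; rewrite -[x]scale1r; apply: lW. Qed.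

Lemma subspaceZ W c x : linear_subspace W -> W x -> W (c *: x).
Proof. by move=> [W0 lW] Wx; rewrite -[_ *: x]addr0; apply: lW. Qed.

Lemma subspaceB W x y : linear_subspace W -> W x -> W y -> W (x - y).
Proof.
by move=> lW Wx Wy; rewrite -scaleN1r; apply/(subspaceD lW)/(subspaceZ _ lW).
Qed.

Lemma subspace_sum W (I : Type) (r : seq I) (P : pred I) (f : I -> M) :
  linear_subspace W -> (forall i, P i -> W (f i)) -> W (\sum_(i <- r | P i) f i).
Proof.
by move=> lW Wf; elim/big_ind: _ => //; [case: lW | move=> x y; apply: subspaceD].
Qed.

Lemma subspace_fsum W (f : nat -> M) :
  linear_subspace W -> (forall i, W (f i)) -> W (\sum_(i \in [set: nat]) f i).
Proof. by move=> lW Wf; apply: subspace_sum. Qed.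

Lemma fsum_ord (f : nat -> M) (n : nat) :
  (forall i, (n <= i)%N -> f i = 0) ->
  \sum_(i \in [set: nat]) f i = \sum_(i < n) f i.
Proof.
move=> f0; rewrite fsbig_ord; apply/esym/fsbig_widen => // i [_ /=].
by move/negP; rewrite -leqNgt => /f0.
Qed.

Lemma lin_span_gen A x : A x -> lin_span A x.
Proof.
move=> Ax; exists 1%N, (fun=> 1), (fun=> x); split=> //.
by rewrite big_ord1 scale1r.
Qed.

Lemma lin_span_min A W : linear_subspace W -> A `<=` W -> lin_span A `<=` W.
Proof.
move=> lW AW x [n [c [a [Aa ->]]]]; apply: subspace_sum => // i _.
exact/(subspaceZ _ lW)/AW.
Qed.

Lemma lin_span_subspace A : linear_subspace (lin_span A).
Proof.
split; first by exists 0%N, (fun=> 0), (fun=> 0); split=> [[]|]; rewrite ?big_ord0.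
move=> c x y [n [d [a [Aa ->]]]] [m [e [b [Ab ->]]]].
exists (n + m)%N,
  (fun i : 'I_(n + m) => match fintype.split i with
            | inl j => c * d j | inr j => e j end),
  (fun i : 'I_(n + m) => match fintype.split i with inl j => a j | inr j => b j end).
split; first by move=> i; case: (fintype.split i).
rewrite big_split_ord /= scaler_sumr; congr (_ + _); apply: eq_bigr => i _.
  by rewrite (unsplitK (inl i)) scalerA.
by rewrite (unsplitK (inr i)).
Qed.

Lemma lin_span_sub A B : A `<=` B -> lin_span A `<=` lin_span B.
Proof.
by move=> AB; apply: lin_span_min (lin_span_subspace B) _ => x /AB /lin_span_gen.
Qed.

Lemma subspace_preimage (N : lmodType K) (f : N -> M) W :
  linear f -> linear_subspace W -> linear_subspace (f @^-1` W).
Proof.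
move=> lf lW; split; first by rewrite /preimage /= (linear_fun0 lf); case: lW.
by move=> c x y Wx Wy; rewrite /preimage /= lf; case: lW => _; apply.
Qed.

End Subspaces.

(** * Decompositions into graded pieces; independence of eigenvectors *)

Section GradedSums.
Variables (K : fieldType) (V : lmodType K).
Implicit Types S : nat -> set V.

(** The components form an infinite sequence vanishing from [n] on, so that [n] can be enlarged and
    two decompositions added termwise. *)
Definition graded_decomp S (n : nat) : set V :=
  [set v | exists a : nat -> V, [/\ forall t, S t (a t),
     forall t, (n <= t)%N -> a t = 0 & v = \sum_(t < n) a t]].

Lemma graded_sum_widen (a : nat -> V) m n : (m <= n)%N ->
  (forall t, (m <= t)%N -> a t = 0) -> \sum_(t < n) a t = \sum_(t < m) a t.
Proof.
move=> mn a0; rewrite -(subnKC mn) big_split_ord /= [X in _ + X]big1 ?addr0 //.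
by move=> i _; rewrite a0 ?leq_addr.
Qed.

Lemma graded_decompW S m n v :
  (m <= n)%N -> graded_decomp S m v -> graded_decomp S n v.
Proof.
move=> mn [a [Sa a0 ->]]; exists a; split=> //.
  by move=> t nt; apply/a0/(leq_trans mn).
by rewrite (graded_sum_widen mn).
Qed.

Lemma graded_sum_subspace S : (forall t, linear_subspace (S t)) ->
  linear_subspace [set v | exists n, graded_decomp S n v].
Proof.
move=> lS; split.
  exists 0%N, (fun=> 0); split=> //; last by rewrite big_ord0.
  by move=> t; case: (lS t).
move=> c x y [m xm] [n yn].
have [a [Sa a0 ->]] := graded_decompW (leq_maxl m n) xm.
have [b [Sb b0 ->]] := graded_decompW (leq_maxr m n) yn.
exists (maxn m n), (fun t => c *: a t + b t); split.
- by move=> t; case: (lS t) => _; apply.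
- by move=> t nt; rewrite a0 // b0 // scaler0 addr0.
- by rewrite big_split /= scaler_sumr.
Qed.

Lemma graded_sum_gen S t v :
  (forall t, linear_subspace (S t)) -> S t v -> exists n, graded_decomp S n v.
Proof.
move=> lS Sv; exists t.+1, (fun i => if i == t then v else 0); split.
- by move=> i; case: eqP => [->|_] //; case: (lS i).
- by move=> i; case: eqP => // ->; rewrite ltnn.
- rewrite big_ord_recr /= eqxx big1 ?add0r // => i _.
  by rewrite ltn_eqF.
Qed.

End GradedSums.

(** Applying [L] minus the top eigenvalue removes the last term and scales every other one by a
    nonzero number, so induction on the number of terms applies. *)
Lemma eigenvectors_sum0 (K : numFieldType) (V : lmodType K) (L : V -> V)
    (n : nat) (b : nat -> V) :
  linear L -> (forall t, L (b t) = t%:R *: b t) ->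
  \sum_(t < n) b t = 0 -> forall t, (t < n)%N -> b t = 0.
Proof.
move=> lL; elim: n b => // n IHn b Lb sum0.
have L_sum m (c : nat -> V) : L (\sum_(t < m) c t) = \sum_(t < m) L (c t).
  elim: m => [|m IHm]; first by rewrite !big_ord0 (linear_fun0 lL).
  by rewrite !big_ord_recr /= -IHm -[X in X + c m]scale1r lL scale1r.
have low0 t : (t < n)%N -> b t = 0.
  move=> tn.
  suff /eqP : (t%:R - n%:R : K) *: b t = 0.
    rewrite scaler_eq0 subr_eq0 eqr_nat => /orP[|/eqP //].
    by rewrite ltn_eqF.
  apply: (IHn (fun t => (t%:R - n%:R) *: b t)) => // [i|].
    by rewrite (linear_funZ _ _ lL) Lb !scalerA mulrC.
  have : L (\sum_(t < n.+1) b t) - n%:R *: (\sum_(t < n.+1) b t) = 0.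
    by rewrite sum0 (linear_fun0 lL) scaler0 subr0.
  rewrite L_sum scaler_sumr -sumrB big_ord_recr /= Lb subrr addr0 => E0.
  rewrite -[RHS]E0; by apply: eq_bigr => i _; rewrite Lb scalerBl.
move=> t; rewrite ltnS leq_eqVlt => /orP[/eqP ->|]; last exact: low0.
by move: sum0; rewrite big_ord_recr /= big1 ?add0r // => i _; apply: low0.
Qed.

(** * Generalized binomial coefficients *)

Section Binomz.
Variable K : numFieldType.

Lemma binomz0 p : binomz K p 0 = 1.
Proof. by rewrite /binomz big_ord0 divr1. Qed.

Lemma binomz_small (n i : nat) : (n < i)%N -> binomz K n%:Z i = 0.
Proof.
move=> ni; rewrite /binomz (bigD1 (Ordinal ni)) //= subrr.
by rewrite !mul0r.
Qed.

Lemma binomz11 : binomz K 1 1 = 1.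
Proof. by rewrite /binomz big_ord1 subr0 divr1. Qed.

Lemma binomzN1 i : (-1) ^+ i * binomz K (-1) i = 1.
Proof.
rewrite /binomz mulrA; apply: (canLR (mulfK _)).
  by rewrite pnatr_eq0 -lt0n fact_gt0.
rewrite mul1r; elim: i => [|i IHi]; first by rewrite big_ord0 mulr1.
rewrite big_ord_recr /= exprS factS natrM -IHi.
have -> : (-1 - i%:Z)%:~R = - i.+1%:R :> K.
  by rewrite -opprD rmorphN /= -[1 + i%:Z]/(i.+1%:Z).
ring.
Qed.

Lemma binomzN_neq0 (n i : nat) : binomz K (- n.+1%:Z) i != 0.
Proof.
rewrite /binomz mulf_neq0 ?invr_eq0 ?pnatr_eq0 -?lt0n ?fact_gt0 //.
by apply/prodf_neq0 => j _; rewrite intr_eq0; lia.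
Qed.

End Binomz.

(** * Special cases of the Jacobi identity *)

Section JacobiConsequences.
Variables (K : numFieldType) (V M : lmodType K).
Variables (YV : V -> int -> V -> V) (Y : V -> int -> M -> M).
Hypotheses (Ybil : modes_bilinear Y) (Ytrunc : modes_truncated Y).
Hypothesis (Yjacobi : jacobi_identity YV Y).
Implicit Types (u v : V) (m : M) (W : set M).

Lemma mode_linearl n m : linear (fun v => Y v n m). Proof. by case: Ybil. Qed.
Lemma mode_linearr v n : linear (Y v n). Proof. by case: Ybil. Qed.
Lemma mode0l n m : Y 0 n m = 0. Proof. exact: linear_fun0 (mode_linearl n m). Qed.
Lemma mode0r v n : Y v n 0 = 0. Proof. exact: linear_fun0 (mode_linearr v n). Qed.

(** The Jacobi identity at [r = 0], where only the term [i = 0] survives on its right side. *)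
Lemma commutator_formula u v p q m :
  Y u p (Y v q m) - Y v q (Y u p m) =
  \sum_(i \in [set: nat])
     binomz K p i *: Y (YV u i%:Z v) (p + q - i%:Z) m.
Proof.
have := Yjacobi u v m p q 0.
rewrite [in RHS](@fsum_ord _ _ _ 1) => [|i i1]; last first.
  by rewrite (@binomz_small _ 0) // mulr0 scale0r.
rewrite big_ord1 binomz0 expr0z !addr0 mulr1 !scale1r => <-.
by apply: eq_fsbigr => i _; rewrite add0r.
Qed.

(** The Jacobi identity at [p = 0] has the single term [(u_r v)_q m] on its left, and on its right a
    combination of the vectors assumed in [W]. *)
Lemma subspace_mode_of_product u v r q m W : linear_subspace W ->
  (forall i : nat, W (Y u (r - i%:Z) (Y v (q + i%:Z) m))) ->
  (forall i : nat, W (Y v (q + r - i%:Z) (Y u i%:Z m))) ->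
  W (Y (YV u r v) q m).
Proof.
move=> lW Wuv Wvu; have := Yjacobi u v m 0 q r.
rewrite [in LHS](@fsum_ord _ _ _ 1) => [|i i1]; last first.
  by rewrite (@binomz_small _ 0) // scale0r.
rewrite big_ord1 binomz0 !addr0 add0r scale1r => ->.
apply: subspace_fsum => // i; rewrite !add0r.
exact/(subspaceZ _ lW)/(subspaceB lW (Wuv i))/(subspaceZ _ lW).
Qed.

(* The Jacobi identity at [p = n + 1], [q = n], [r = -1]: the term
   [u_n v_n m] is the only one with equal modes. *)
Lemma subspace_repeated_mode u v n m W : linear_subspace W ->
  (forall i : nat, W (Y (YV u (i%:Z - 1) v) (n + n + 1 - i%:Z) m)) ->
  (forall i : nat, W (Y u (n - i.+1%:Z) (Y v (n + i.+1%:Z) m))) ->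
  (forall i : nat, W (Y v (n - i.+1%:Z) (Y u (n + i.+1%:Z) m))) ->
  W (Y u n (Y v n m)).
Proof.
move=> lW Wl Wuv Wvu; have := Yjacobi u v m (n + 1) n (-1).
set lhs := (X in X = _); have Wlhs : W lhs.
  apply: subspace_fsum => // i; apply: subspaceZ => //.
  by rewrite [-1 + _]addrC (addrAC n).
move=> lhsE; rewrite lhsE in Wlhs; move: Wlhs; clear lhs lhsE Wl.
have [Nv v0] := Ytrunc v m; have [Nu u0] := Ytrunc u m.
(* Past this cutoff both inner modes kill [m]; the successor lets the term [i = 0], which holds
   [u_n v_n m], be split off. *)
rewrite (@fsum_ord _ _ _ (`|Nv - n| + `|Nu - n|).+1) => [|i Ni]; last first.
  by rewrite v0 ?u0 ?mode0r ?scaler0 ?subr0 ?scaler0 //; lia.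
have sgn : (-1 : K) ^ (-1 : int) = -1 by rewrite -[LHS]/((-1)^-1) invrN1.
pose f i := Y u (n - i%:Z) (Y v (n + i%:Z) m)
            + Y v (n - i.+1%:Z) (Y u (n + i.+1%:Z) m).
rewrite (eq_bigr (fun i : 'I_ _ => f i)) => [|i _]; last first.
  rewrite binomzN1 scale1r sgn scaleN1r opprK /f.
  by congr (Y _ _ (Y _ _ _) + Y _ _ (Y _ _ _)); lia.
rewrite big_ord_recl /= => Wsum.
have -> : Y u n (Y v n m) =
    f 0%N + (\sum_(i < `|Nv - n| + `|Nu - n|) f (bump 0 i))
    - (\sum_(i < `|Nv - n| + `|Nu - n|) f (bump 0 i))
    - Y v (n - 1%:Z) (Y u (n + 1%:Z) m).
  by rewrite addrK /f !addr0 addrK.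
do 2![apply: (subspaceB lW) => //].
by apply: subspace_sum => // i _; apply: subspaceD => //; apply: Wuv.
Qed.

(* [v_{-2} 1] plays the role of [L(-1) v]. *)
Lemma C_span_lower_mode (vac : V) v (n j : nat) m : modes_vacuum vac Y ->
  C_span Y n.+1 (Y v (- (n.+1 + j)%:Z) m).
Proof.
move=> Yvac; elim: j v => [|j IHj] v.
  by rewrite addn0; apply: lin_span_gen; exists v, m.
(* This instance computes [(v_{-2} 1)_{-k} m], which the induction hypothesis covers. *)
set k := (n.+1 + j)%N in IHj *; have := Yjacobi v vac m 0 (- k%:Z) (- 2%:Z).
rewrite [in LHS](@fsum_ord _ _ _ 1) => [|i i1]; last first.
  by rewrite (@binomz_small _ 0) // scale0r.
rewrite big_ord1 binomz0 !addr0 add0r scale1r.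
rewrite [in RHS](@fsum_ord _ _ _ k) => [|i ki]; last first.
  rewrite !Yvac ifF 1?ifF ?mode0r ?scaler0 ?subr0 ?scaler0 //; lia.
have k_gt0 : (0 < k)%N by [].
(* The inner vacuum mode [- k + i] is [-1] only for [i = k - 1], and the outer one never is; what
   survives is a nonzero multiple of [v_{-k-1} m]. *)
rewrite (bigD1 (Ordinal (_ : k.-1 < k)%N)) /= ?prednK // big1 ?addr0.
  rewrite Yvac ifT; last by lia.
  rewrite Yvac ifF ?scaler0 ?subr0; last by lia.
  set c := _ * _; have c0 : c != 0.
    by rewrite mulf_neq0 ?signr_eq0 ?binomzN_neq0.
  rewrite (_ : 0 + _ - _ = - (n.+1 + j.+1)%:Z); last by lia.
  move=> E; rewrite -[Y _ _ _](scalerK c0) -E.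
  exact/(subspaceZ _ (lin_span_subspace _))/IHj.
move=> i /eqP ik; have {}ik : (i : nat) <> k.-1.
  by move=> e; apply: ik; apply: val_inj.
by rewrite !Yvac ifF 1?ifF ?mode0r ?scaler0 ?subr0 ?scaler0 //; lia.
Qed.

End JacobiConsequences.

(** * Weights in [V] and the grading of [C_2(V)] *)

Section WeightSpaces.
Variables (R : realType) (V : voa R).
Implicit Types (u v : V).

Local Notation Y := (@vertex_op R V).

Lemma voa_weight_subspace n : linear_subspace (voa_weight V n).
Proof.
have lL := mode_linearr (voa_bilinear V) (conformal_vector V) (0 + 1).
split; rewrite /voa_weight /weight_space /virasoro_mode /=.
  by rewrite scaler0 (linear_fun0 lL).
by move=> c x y xn yn; rewrite lL xn yn scalerDr !scalerA mulrC.
Qed.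

(** Since [L(0) = omega_1], the commutator formula at [p = 1] gives [[L(0), u_i] = (L(-1) u)_{i+1} +
    (L(0) u)_i], and the derivative axiom turns the first term into [- (i + 1) u_i]. *)
Lemma voa_weight_mode u v (s t i : int) :
  voa_weight V s u -> voa_weight V t v -> voa_weight V (s + t - i - 1) (Y u i v).
Proof.
rewrite /voa_weight /weight_space /virasoro_mode /= add0r => us vt.
have Ybil := voa_bilinear V.
have := commutator_formula (@voa_jacobi R V) (conformal_vector V) u 1 i v.
rewrite (@fsum_ord _ _ _ 2) => [|j j1]; last first.
  by rewrite (@binomz_small _ 1) // scale0r.
rewrite big_ord_recr big_ord1 /= binomz0 binomz11 !scale1r vt.
rewrite (linear_funZ _ _ (mode_linearr Ybil _ _)) us subr0.
have -> : Y (conformal_vector V) 0 u =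
    virasoro_mode Y (conformal_vector V) (-1) u by rewrite /virasoro_mode addNr.
rewrite voa_L_derivative (linear_funZ _ _ (mode_linearl Ybil _ _)).
rewrite (_ : 1 + i - 1 = i); last by rewrite addrAC subrr add0r.
move=> /(canRL (subrK _)) ->.
by rewrite -!scalerDl -!rmorphD /=; congr (_%:~R *: _); lia.
Qed.

Hypothesis hCFT : CFT_type V.

Lemma voa_weight_neg0 (n : int) v : n < 0 -> voa_weight V n v -> v = 0.
Proof. by case: hCFT => neg0 _ /neg0 ->. Qed.

Lemma homogeneous_span :
  lin_span [set v | exists n : nat, voa_weight V n%:Z v] = [set: V].
Proof.
apply/seteqP; split=> // v _.
have : [set: V] v by []; rewrite -(voa_graded V); move: v.
apply: lin_span_min (lin_span_subspace _) _ => v [[n|n] _ vn].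
  by apply: lin_span_gen; exists n.
rewrite (@voa_weight_neg0 (Negz n) v) //.
by case: (lin_span_subspace [set v | exists n : nat, voa_weight V n%:Z v]).
Qed.

(** A product [u_{-2} v] has weight [s + t + 1], so the two factors together weigh only [n - 1];
    this is the gain used in [act_C2_letter]. *)
Definition C2_weight (n : nat) : set V :=
  lin_span [set x | exists (s t : nat) (u v : V),
    [/\ voa_weight V s%:Z u, voa_weight V t%:Z v, (s + t).+1 = n
      & x = Y u (- 2%:Z) v]].

Lemma C2_weight_subspace n : linear_subspace (C2_weight n).
Proof. exact: lin_span_subspace. Qed.

Lemma C2_weight_sub n : C2_weight n `<=` voa_weight V n%:Z.
Proof.
apply: lin_span_min (voa_weight_subspace _) _ => x [s [t [u [v [us vt <- ->]]]]].
by have := voa_weight_mode (- 2%:Z) us vt; congr (voa_weight V _ _); lia.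
Qed.

Lemma C2_weight_sum v :
  C_span Y 2 v -> exists n, graded_decomp C2_weight n v.
Proof.
have lS := graded_sum_subspace C2_weight_subspace.
move: v; apply: lin_span_min => // x [u [v ->]].
have : [set: V] u by []; rewrite -homogeneous_span; move: u.
apply: lin_span_min.
  exact: subspace_preimage (mode_linearl (voa_bilinear V) _ _) lS.
move=> u [s us] /=.
have : [set: V] v by []; rewrite -homogeneous_span; move: v.
apply: lin_span_min.
  exact: subspace_preimage (mode_linearr (voa_bilinear V) _ _) lS.
move=> v [t vt]; apply: (@graded_sum_gen _ _ _ (s + t).+1 _ C2_weight_subspace).
by apply: lin_span_gen; exists s, t, u, v.
Qed.

(** A vector of weight [n] is its own component of weight [n]; once [n] exceeds all weights
    occurring in finitely many representatives of [V / C_2(V)], that component comes from [C_2(V)]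
    alone. *)
Lemma C2_cofinite_high_weight : voa_C2_cofinite V ->
  exists N : nat, forall (n : nat) v,
    (N <= n)%N -> voa_weight V n%:Z v -> C2_weight n v.
Proof.
move=> [s Vs].
have lV n := voa_weight_subspace n%:Z.
have [N sN] : exists N, forall x, x \in s ->
    graded_decomp (fun t => voa_weight V t%:Z) N x.
  apply: seq_uniform_bound => [x m n mn|x _]; first exact: graded_decompW.
  have : [set: V] x by []; rewrite -homogeneous_span; move: x.
  apply: lin_span_min (graded_sum_subspace lV) _ => x [n xn].
  exact: graded_sum_gen xn.
exists N => n v Nn vn.
(* Both summands of [v] decompose along [S]: the part in [C_2(V)], and the combination of
   representatives, whose components vanish from [N] on. *)
pose S t := [set x | voa_weight V t%:Z x /\ ((N <= t)%N -> C2_weight t x)].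
have lS t : linear_subspace (S t).
  have [V0 VD] := lV t; have [C0 CD] := C2_weight_subspace t.
  split=> [|c x y [Vx Cx] [Vy Cy]]; first by split.
  by split=> [|Nt]; [apply: VD | apply: CD; [apply: Cx|apply: Cy]].
have [m [a [Sa a0 va]]] : exists m, graded_decomp S m v.
  have [y [ys vy]] := Vs v; rewrite -[v](subrK y).
  apply: (subspaceD (graded_sum_subspace lS)).
    have [m [a [Ca a0 ->]]] := C2_weight_sum vy.
    by exists m, a; split=> // t; split=> //; apply: C2_weight_sub.
  move: y ys {vy}; apply: lin_span_min (graded_sum_subspace lS) _ => y /= /sN.
  move=> [a [Va a0 ->]]; exists N, a; split=> // t; split=> // Nt.
  by rewrite a0 //; case: (C2_weight_subspace t).
have {Nn}Cn := (Sa n).2 Nn.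
suff -> : v = a n by [].
(* The difference between the decomposition found and the trivial one, with [v] alone in degree [n];
   its sum is zero, so independence of eigenvectors applies. *)
pose b t := a t - (if t == n then v else 0).
suff /eqP : b n = 0 by rewrite /b eqxx subr_eq0 => /eqP.
apply: (@eigenvectors_sum0 _ _ (virasoro_mode Y (conformal_vector V) 0)
         (maxn m n.+1) b); last exact: leq_maxr.
- exact: mode_linearr (voa_bilinear V) _ _.
- move=> t; apply: (subspaceB (lV t)); first exact: (Sa t).1.
  by case: eqP => [->|_] //; case: (lV t).
- rewrite sumrB (graded_sum_widen (leq_maxl m n.+1) a0) -va.
  rewrite (bigD1 (Ordinal (leq_maxr m n.+1))) //= eqxx big1 ?addr0 ?subrr //.
  by move=> t tn; rewrite ifF //; apply: negbTE.
Qed.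

End WeightSpaces.

Lemma finite_dim_weights_below (R : realType) (V : voa R) (N : nat) :
  exists A : seq V, forall n : nat, (n < N)%N ->
    voa_weight V n%:Z `<=` lin_span [set` A].
Proof.
elim: N => [|N [A AN]]; first by exists [::].
have [B BN] := voa_weight_finite_dim V N%:Z.
exists (A ++ B) => n; rewrite ltnS leq_eqVlt => /orP[/eqP ->|nN].
  apply: subset_trans BN _; apply: lin_span_sub => x /= xB.
  by rewrite mem_cat xB orbT.
apply: subset_trans (AN n nN) _; apply: lin_span_sub => x /= xA.
by rewrite mem_cat xA.
Qed.

(** * Words in modes of homogeneous vectors *)

Section Words.
Variables (R : realType) (V : voa R) (M : weak_module V).
Hypothesis hCFT : CFT_type V.

(* [((v, n), s)] stands for the operator [v_n], where [v] has weight [s]. *)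
Notation letter := (V * int * nat)%type.
Implicit Types (p q : seq letter) (x y : letter) (m w : M) (W : set M).

Local Notation Y := (@wmod_op R V M).
Let Ybil : modes_bilinear Y := wmod_bilinear M.
Let Yjac : jacobi_identity (@vertex_op R V) Y := @wmod_jacobi R V M.

Definition act p m : M := foldr (fun x => Y x.1.1 x.1.2) m p.

Definition homogeneous p := forall x, x \in p -> voa_weight V x.2%:Z x.1.1.

Definition total_weight p := \sum_(x <- p) x.2.

Lemma act_linear p : linear (act p).
Proof.
elim: p => //= x p IHp c m m' /=.
by rewrite IHp (mode_linearr Ybil).
Qed.

Lemma act_cat p q m : act (p ++ q) m = act p (act q m).
Proof. exact: foldr_cat. Qed.

Lemma homogeneous_cons x p :
  homogeneous (x :: p) <-> voa_weight V x.2%:Z x.1.1 /\ homogeneous p.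
Proof.
split=> [h|[hx h] y]; last by rewrite inE => /orP[/eqP ->|/h].
by split=> [|y yp]; apply: h; rewrite inE ?eqxx // yp orbT.
Qed.

Lemma homogeneous_cat p q :
  homogeneous (p ++ q) <-> homogeneous p /\ homogeneous q.
Proof.
split=> [h|[hp hq] x]; last by rewrite mem_cat => /orP[/hp|/hq].
by split=> x xs; apply: h; rewrite mem_cat xs ?orbT.
Qed.

Lemma perm_homogeneous p q : perm_eq p q -> homogeneous p -> homogeneous q.
Proof. by move=> /perm_mem pq h x; rewrite -pq => /h. Qed.

Lemma perm_total_weight p q : perm_eq p q -> total_weight p = total_weight q.
Proof. by move=> pq; apply: perm_big. Qed.

Lemma total_weight_cat p q :
  total_weight (p ++ q) = (total_weight p + total_weight q)%N.
Proof. exact: big_cat. Qed.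

Lemma total_weight_cons x p :
  total_weight (x :: p) = (x.2 + total_weight p)%N.
Proof. exact: big_cons. Qed.

(** * Rewriting words modulo smaller total weight *)

Section ModuloLowerWeight.
Variables (w : M) (W : set M) (r : nat).
Hypothesis lW : linear_subspace W.
Hypothesis low : forall p, homogeneous p -> (total_weight p < r)%N -> W (act p w).

(** The weight [k] is an integer because a product [u_i v] may have formally negative weight; CFT
    type then forces [v = 0]. *)
Lemma act_low p q v (n k : int) : homogeneous p -> homogeneous q ->
  voa_weight V k v -> (total_weight p)%:Z + k + (total_weight q)%:Z < r%:Z ->
  W (act p (Y v n (act q w))).
Proof.
move=> hp hq; case: k => k vk ltr.
  have := low (p := p ++ (v, n, k) :: q); rewrite act_cat; apply.
    by apply/homogeneous_cat; split=> //; apply/homogeneous_cons.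
  by rewrite total_weight_cat total_weight_cons /=; lia.
rewrite (voa_weight_neg0 hCFT _ vk) // (mode0l Ybil).
by rewrite (linear_fun0 (act_linear p)); case: lW.
Qed.

(** The product with index [i] in the commutator weighs [i + 1] less than the two letters together,
    so [low] disposes of it. *)
Lemma act_swap p x y q : homogeneous (p ++ x :: y :: q) ->
  (total_weight (p ++ x :: y :: q) <= r)%N ->
  W (act (p ++ x :: y :: q) w) -> W (act (p ++ y :: x :: q) w).
Proof.
move=> /homogeneous_cat[hp /homogeneous_cons[hx /homogeneous_cons[hy hq]]].
rewrite total_weight_cat !total_weight_cons !act_cat /= => wr Wxy.
set m := act q w in Wxy *.
have lWp := subspace_preimage (act_linear p) lW.
suff Wc : W (act p (Y x.1.1 x.1.2 (Y y.1.1 y.1.2 m)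
                    - Y y.1.1 y.1.2 (Y x.1.1 x.1.2 m))).
  by rewrite -[X in act p X](subKr (Y x.1.1 x.1.2 (Y y.1.1 y.1.2 m)));
     apply: (subspaceB lWp).
rewrite (commutator_formula Yjac).
apply: (subspace_fsum lWp) => i; apply: (subspaceZ _ lWp).
apply: (act_low _ hp hq (voa_weight_mode _ hx hy)).
lia.
Qed.

Lemma act_perm p q : perm_eq p q -> homogeneous p -> (total_weight p <= r)%N ->
  W (act p w) -> W (act q w).
Proof.
have bubble p0 x t1 t2 : homogeneous (p0 ++ x :: t1 ++ t2) ->
    (total_weight (p0 ++ x :: t1 ++ t2) <= r)%N ->
    W (act (p0 ++ x :: t1 ++ t2) w) -> W (act (p0 ++ t1 ++ x :: t2) w).
  elim: t1 p0 => //= y t1 IHt p0 h wr Wx.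
  have pe : perm_eq (p0 ++ x :: y :: t1 ++ t2) (rcons p0 y ++ x :: t1 ++ t2).
    rewrite cat_rcons perm_cat2l.
    by rewrite -[x :: y :: _]/([:: x] ++ [:: y] ++ _) perm_catCA.
  rewrite -cat_rcons; apply: IHt.
  - exact: perm_homogeneous pe h.
  - by rewrite -(perm_total_weight pe).
  - by rewrite cat_rcons; apply: act_swap.
(* [p0] is the prefix on which the two words already agree. *)
suff gen p0 : perm_eq p q -> homogeneous (p0 ++ p) ->
    (total_weight (p0 ++ p) <= r)%N -> W (act (p0 ++ p) w) ->
    W (act (p0 ++ q) w) by apply: (gen [::]).
elim: p q p0 => [|x p IHp] q p0 pq h wr Wp.
  by move: pq; rewrite perm_sym => /perm_nilP ->.
have /path.splitPr xq : x \in q by rewrite -(perm_mem pq) mem_head.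
case: xq pq => t1 t2 pq.
have pt : perm_eq p (t1 ++ t2).
  by move: pq; rewrite perm_sym -[x :: t2]cat1s perm_catCA /= perm_cons perm_sym.
have pe : perm_eq (p0 ++ x :: p) (p0 ++ x :: t1 ++ t2).
  by rewrite perm_cat2l perm_cons.
apply: bubble; [exact: perm_homogeneous pe h|by rewrite -(perm_total_weight pe)|].
by rewrite -cat_rcons; apply: IHp; rewrite ?cat_rcons.
Qed.

(** A letter [(u_{-2} v)_n] expands into products [u_a v_b] and [v_b u_a], whose two letters have
    total weight [s - 1]. *)
Lemma act_C2_letter v n s q : C2_weight s v -> homogeneous q ->
  (s + total_weight q <= r)%N -> W (Y v n (act q w)).
Proof.
move=> Cv hq wr; move: v Cv; apply: lin_span_min.
  exact: subspace_preimage (mode_linearl Ybil _ _) lW.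
move=> _ [i [j [u [v [ui vj ij ->]]]]] /=.
apply: (subspace_mode_of_product Yjac lW) => k.
  have hvq : homogeneous ((v, n + k%:Z, j) :: q) by apply/homogeneous_cons.
  have := act_low (p := [::]) (- 2%:Z - k%:Z) _ hvq ui; apply=> //.
  by rewrite /total_weight big_nil -/(total_weight _) total_weight_cons /=; lia.
have huq : homogeneous ((u, k%:Z, i) :: q) by apply/homogeneous_cons.
have := act_low (p := [::]) (n - 2%:Z - k%:Z) _ huq vj; apply=> //.
by rewrite /total_weight big_nil -/(total_weight _) total_weight_cons /=; lia.
Qed.

End ModuloLowerWeight.

(** * Words with bounded length and bounded modes *)

Fixpoint bounded_products (A : seq V) (B : nat) (w : M) (k : nat) : seq M :=
  if k is k'.+1 then
    let E := bounded_products A B w k' in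
    E ++ [seq Y z.1 z.2 m | z <- [seq (a, i%:Z - B%:Z) | a <- A, i <- iota 0 B.*2],
                            m <- E]
  else [:: w].

(** Multilinearity reduces letters in the span of [A] to letters in [A]; shorter words are covered
    because each stage of the list retains the previous one. *)
Lemma act_bounded (A : seq V) (B : nat) (w : M) (k : nat) p :
  (forall x, x \in p ->
     lin_span [set` A] x.1.1 /\ (`|x.1.2| < B)%N) ->
  (size p <= k)%N ->
  lin_span [set` bounded_products A B w k] (act p w).
Proof.
elim: k p => [|k IHk] [|x p] //= hp sp.
- by apply: lin_span_gen; rewrite /= mem_head.
- apply: (@lin_span_sub _ _ [set` bounded_products A B w k]).
    by move=> m /= mE; rewrite mem_cat mE.
  exact: (IHk [::]).
have {}IHk : lin_span [set` bounded_products A B w k] (act p w).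
  by apply: IHk => // y yp; apply: hp; rewrite inE yp orbT.
have [vA xB] := hp x (mem_head x p).
move: (act p w) IHk; apply: lin_span_min.
  exact: subspace_preimage (mode_linearr Ybil _ _) (lin_span_subspace _).
move=> m /= mE; move: x.1.1 vA; apply: lin_span_min.
  exact: subspace_preimage (mode_linearl Ybil _ _) (lin_span_subspace _).
move=> a /= aA; apply: lin_span_gen; rewrite /= mem_cat; apply/orP; right.
apply/allpairsP; exists ((a, x.1.2), m); split=> //=.
apply/allpairsP; exists (a, `|(x.1.2 + B%:Z)%R|%N); split=> //=.
  by rewrite mem_iota; lia.
by congr (_, _); lia.
Qed.

(** A measure of spread: replacing modes [i], [i] by [i - d], [i + d] raises it by [2 d^2]. *)
Definition mode_square_sum p := (\sum_(x <- p) `|x.1.2| ^ 2)%N.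

Lemma mode_square_sum_cons x p :
  mode_square_sum (x :: p) = (`|x.1.2| ^ 2 + mode_square_sum p)%N.
Proof. exact: big_cons. Qed.

Lemma perm_mode_square_sum p q :
  perm_eq p q -> mode_square_sum p = mode_square_sum q.
Proof. by move=> pq; apply: perm_big. Qed.

Lemma mode_square_sum_le p (B : nat) :
  (forall x, x \in p -> (`|x.1.2| < B)%N) ->
  (mode_square_sum p <= size p * B ^ 2)%N.
Proof.
move=> hp; rewrite /mode_square_sum big_seq.
rewrite (leq_trans (n := \sum_(x <- p | x \in p) B ^ 2)%N) //.
  by apply: leq_sum => x /hp xB; rewrite leq_exp2r // ltnW.
by rewrite -big_seq big_const_seq count_predT iter_addn_0 mulnC.
Qed.

Lemma repeated_mode p (B : nat) :
  (forall x, x \in p -> (`|x.1.2| < B)%N) -> (B.*2 < size p)%N ->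
  exists x y q, perm_eq p (x :: y :: q) /\ x.1.2 = y.1.2.
Proof.
move=> hp sp; apply: (@not_uniq_map_perm _ _ (fun x : letter => x.1.2)).
apply: contraL sp => u; rewrite -leqNgt.
rewrite -(size_map (fun x : letter => x.1.2)) -(size_iota 0 B.*2).
rewrite -(size_map (fun i : nat => i%:Z - B%:Z)) uniq_leq_size // => n.
move=> /mapP[[[v i] s] /hp /= iB ->]; apply/mapP; exists `|(i + B%:Z)%R|%N.
  by rewrite mem_iota; lia.
lia.
Qed.

Lemma truncated_below (A : seq V) (w : M) : exists B : nat,
  forall v (n : int), lin_span [set` A] v -> B%:Z <= n -> Y v n w = 0.
Proof.
have [B AB] : exists B : nat, forall v, v \in A ->
    forall n : int, B%:Z <= n -> Y v n w = 0.
  apply: seq_uniform_bound => [v k l kl hk n ln|v _]; first by apply: hk; lia.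
  have [N hN] := @wmod_truncated _ _ M v w.
  by exists `|N|%N => n Nn; apply: hN; lia.
exists B => v n Av Bn; move: v Av.
apply: (lin_span_min (W := [set v | Y v n w = 0])).
  split=> [|c u v /= u0 v0]; first exact: mode0l Ybil _ _.
  by rewrite (mode_linearl Ybil) u0 v0 scaler0 addr0.
by move=> v /= vA; apply: AB.
Qed.

(** * Reduction of words to [C_{n+1}(M)] plus a finite-dimensional space *)

Section Spanning.
Variables (w : M) (n : nat) (N B : nat) (A : seq V).
Hypothesis high : forall (s : nat) v,
  (N <= s)%N -> voa_weight V s%:Z v -> C2_weight s v.
Hypothesis AN : forall s : nat, (s < N)%N ->
  voa_weight V s%:Z `<=` lin_span [set` A].
Hypothesis AB : forall v (i : int),
  lin_span [set` A] v -> B%:Z <= i -> Y v i w = 0.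
Hypothesis nB : (n < B)%N.

(** The representative [e] is explicit so that membership of every vector is literally finite
    codimension of [C_{n+1}(M)]; beyond length [2B] the lemma [repeated_mode] applies. *)
Definition C_span_plus_finite : set M :=
  [set m | exists e, lin_span [set` bounded_products A B w B.*2] e
                     /\ C_span Y n.+1 (m - e)].

Lemma C_span_plus_finite_subspace : linear_subspace C_span_plus_finite.
Proof.
have [E0 ED] := lin_span_subspace [set` bounded_products A B w B.*2].
have lC : linear_subspace (C_span Y n.+1) by apply: lin_span_subspace.
split=> [|c x y [e [Ee Ce]] [f [Ef Cf]]].
  by exists 0; split=> //; rewrite subr0; case: lC.
exists (c *: e + f); split; first exact: ED.
by rewrite opprD addrACA -scalerBr; case: lC => _; apply.
Qed.

Local Notation W := C_span_plus_finite.
Local Notation lW := C_span_plus_finite_subspace.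

Lemma C_span_sub_plus_finite m : C_span Y n.+1 m -> W m.
Proof.
by move=> Cm; exists 0; split; rewrite ?subr0 //; case: (lin_span_subspace
  [set` bounded_products A B w B.*2]).
Qed.

Lemma act_in_plus_finite p : homogeneous p -> W (act p w).
Proof.
have [r] := ubnP (total_weight p); elim: r p => // r low p pr hp.
have {}low q : homogeneous q -> (total_weight q < r)%N -> W (act q w).
  by move=> hq qr; apply: low.
rewrite ltnS in pr.
have in_range q : homogeneous q -> (total_weight q <= r)%N ->
    ((forall x, x \in q -> lin_span [set` A] x.1.1 /\ (`|x.1.2| < B)%N) ->
     W (act q w)) -> W (act q w).
  move=> hq qr Wq.
  have front x : x \in q -> (homogeneous (x :: rem x q) ->
      (total_weight (x :: rem x q) <= r)%N -> W (act (x :: rem x q) w)) ->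
      W (act q w).
    move=> /perm_to_rem pe Wx; have hx := perm_homogeneous pe hq.
    have xr : (total_weight (x :: rem x q) <= r)%N.
      by rewrite -(perm_total_weight pe).
    by apply: (act_perm lW low _ hx xr (Wx hx xr)); rewrite perm_sym.
  have [/hasP[x xq Nx]|/hasPn weight_lt] :=
      boolP (has (fun x : letter => N <= x.2)%N q).
    apply: (front x xq) => /homogeneous_cons[hx hrem] xr.
    rewrite total_weight_cons in xr.
    exact: (act_C2_letter lW low _ (high Nx hx) hrem xr).
  have [/hasP[[[v i] s] xq /= xB]|/hasPn mode_gt] :=
      boolP (has (fun x : letter => x.1.2 <= - B%:Z) q).
    apply: (front _ xq) => _ _; apply: C_span_sub_plus_finite => /=.
    (* Since [n < B], a mode at most [-B] is also at most [-(n + 1)]. *)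
    have -> : i = - (n.+1 + (`|i| - n.+1))%:Z by lia.
    exact: (C_span_lower_mode Ybil Yjac _ _ _ _ (@wmod_vacuum R V M)).
  have span_A x : x \in q -> lin_span [set` A] x.1.1.
    by move=> xq; apply: (AN (s := x.2)); [rewrite ltnNge weight_lt | apply: hq].
  have [/hasP[x xq /= xB]|/hasPn mode_lt] :=
      boolP (has (fun x : letter => B%:Z <= x.1.2) q).
    apply: (front x xq) => hx xr.
    have pe : perm_eq (x :: rem x q) (rem x q ++ [:: x]).
      by rewrite -cat1s perm_catC.
    apply: (act_perm lW low (p := rem x q ++ [:: x])).
    - by rewrite perm_sym.
    - exact: perm_homogeneous pe hx.
    - by rewrite -(perm_total_weight pe).
    rewrite act_cat /= (AB (span_A x xq) xB) (linear_fun0 (act_linear _)).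
    by case: lW.
  apply: Wq => x xq; split; first exact: span_A.
  case: x xq => [[v i] s] xq.
  by have /= := mode_gt _ xq; have /= := mode_lt _ xq; lia.
have [k] := ubnP (size p); elim: k p pr hp => // k IHk p pr hp.
rewrite ltnS => sp.
(* [j] exceeds the room left below [k * B ^ 2], which bounds the sum of squares of at most [k] modes
   in range; [j = 0] is contradictory. *)
have [j] : exists j, (k * B ^ 2 < mode_square_sum p + j)%N.
  by exists (k * B ^ 2).+1; rewrite addnS ltnS leq_addl.
elim: j p pr hp sp => [|j IHj] p pr hp sp spread; apply: in_range => // p_range.
  have := mode_square_sum_le (fun x xp => (p_range x xp).2).
  have : (size p * B ^ 2 <= k * B ^ 2)%N by rewrite leq_mul2r sp orbT.
  lia.
have [short|long] := leqP (size p) B.*2.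
  exists (act p w); split; first exact: act_bounded.
  rewrite subrr.
  by case: (lin_span_subspace [set x | exists v m, x = Y v (- n.+1%:Z) m]).
have [x [y [q [pe xy]]]] := repeated_mode (fun x xp => (p_range x xp).2) long.
have := perm_homogeneous pe hp; have := perm_size pe; move: spread pr.
rewrite (perm_total_weight pe) (perm_mode_square_sum pe).
rewrite !mode_square_sum_cons !total_weight_cons /= => spread pr psize hxy.
apply: (act_perm lW low (p := x :: y :: q)) => //.
- by rewrite perm_sym.
- by rewrite !total_weight_cons.
case: x y xy hxy spread pr {pe} => [[u i] s] [[v i'] t] /= <- {i'}.
move=> /homogeneous_cons[/= us /homogeneous_cons[/= vt hq]] spread pr.
(* Stated for generic letters to serve both orders of [u] and [v]; the sum of squares grows by
   [2 (d + 1)^2], so the induction on [j] applies. *)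
have wider u' v' s' t' (d : nat) : voa_weight V s'%:Z u' -> voa_weight V t'%:Z v' ->
    (s' + t' = s + t)%N ->
    W (Y u' (i - d.+1%:Z) (Y v' (i + d.+1%:Z) (act q w))).
  move=> us' vt' st.
  apply: (IHj ((u', i - d.+1%:Z, s') :: (v', i + d.+1%:Z, t') :: q)).
  - by rewrite !total_weight_cons /=; lia.
  - by apply/homogeneous_cons; split=> //; apply/homogeneous_cons.
  - by rewrite /= -psize.
  - rewrite !mode_square_sum_cons /=.
    have : (`|i| ^ 2 + `|i| ^ 2 < `|(i - d.+1%:Z)%R| ^ 2 + `|(i + d.+1%:Z)%R| ^ 2)%N.
      by nia.
    lia.
apply: (subspace_repeated_mode Ybil (@wmod_truncated R V M) Yjac lW) => d.
(* For [d = 0] the letter [u_{-1} v] has weight [s + t] and the word is one letter shorter; for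
   [d > 0] the weight is [s + t - d], so the total drops. *)
- have wt := voa_weight_mode (d%:Z - 1) us vt.
  case: d wt => [|d] wt.
    apply: (IHk ((vertex_op u (0 - 1) v, i + i + 1 - 0, (s + t)%N) :: q)).
    + by rewrite total_weight_cons /=; lia.
    + apply/homogeneous_cons; split=> //=.
      by move: wt; congr (voa_weight V _ _); lia.
    + by move: sp; rewrite psize /=; lia.
  have := act_low lW low (p := [::]) (i + i + 1 - d.+1%:Z) _ hq wt.
  by apply=> //; rewrite /total_weight big_nil -/(total_weight _); lia.
- exact: (wider _ _ _ _ _ us vt).
- exact: (wider _ _ _ _ _ vt us (addnC t s)).
Qed.

End Spanning.

(** * Generation of [M] by words, and the conclusion *)

Lemma words_span (w : M) : irreducible_weak_module M -> w != 0 ->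
  lin_span [set m | exists p, homogeneous p /\ m = act p w] = [set: M].
Proof.
move=> [_ irr] w0; set S := lin_span _.
have lS : linear_subspace S by apply: lin_span_subspace.
have [] // := irr S; last first.
  move=> S0; have : S w by apply: lin_span_gen; exists [::].
  by rewrite S0 /= => /eqP; rewrite (negbTE w0).
(* Stability under all modes follows by linearity from prefixing one homogeneous letter to a
   word. *)
split=> // v i; apply: lin_span_min.
  exact: subspace_preimage (mode_linearr Ybil _ _) lS.
move=> _ [p [hp ->]] /=.
have : [set: V] v by []; rewrite -(homogeneous_span hCFT); move: v.
apply: lin_span_min.
  exact: subspace_preimage (mode_linearl Ybil _ _) lS.
move=> v [s vs]; apply: lin_span_gen; exists ((v, i, s) :: p); split=> //.
exact/homogeneous_cons.
Qed.

End Words.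

Theorem corollary5p3 (R : realType) (V : voa R) (M : weak_module V)
    (hV : voa_C2_cofinite V) (hCFT : CFT_type V)
    (hirr : irreducible_weak_module M) (hM : wmod_C_cofinite M 2) :
  forall n : nat, (2 <= n)%N -> wmod_C_cofinite M n.
Proof.
(* From here on [n] is one less than the index in the statement. *)
move=> [//|n] _; have [[w w0] _] := hirr.
have [N high] := C2_cofinite_high_weight hCFT hV.
have [A AN] := finite_dim_weights_below V N.
have [B0 AB0] := truncated_below A w.
(* [B0] makes modes at least [B] kill [w]; [n.+1] makes modes at most [-B] produce elements of
   [C_{n+1}(M)]. *)
pose B := maxn B0 n.+1.
have AB v (i : int) : lin_span [set` A] v -> B%:Z <= i -> wmod_op v i w = 0.
  by move=> Av Bi; apply: AB0 => //; rewrite /B in Bi; lia.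
have nB : (n < B)%N by rewrite leq_maxr.
exists (bounded_products A B w B.*2) => x.
have : [set: M] x by []; rewrite -(words_span hCFT hirr w0); move: x.
apply: lin_span_min (C_span_plus_finite_subspace w n B A) _.
by move=> _ [p [hp ->]]; apply: (act_in_plus_finite hCFT high AN AB nB).
Qed.
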